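(* The $\sigma$-ideals $J_0(\lambda)$ on $[0,1]$, $J_0(\mathscr{H}^1)$ on $[0,1]^2$ and $J_f(\mathscr{H}^1)$ on $[0,1]^2$ are not homogeneous.
   Context: $\lambda$ is the Lebesgue measure on $[0,1]$ and $\mathscr{H}^1$ is the 1-dimensional Hausdorff measure on (Borel sets of) the Euclidean square $[0,1]^2$. For a Borel measure $\mu$ on a compact metrizable space $X$, $J_f(\mu)$ (respectively $J_0(\mu)$) is the $\sigma$-ideal of Borel sets in $X$ that can be covered by countably many compact subsets of $X$ of finite $\mu$-measure (respectively of $\mu$-measure zero). $Bor(X)$ is the $\sigma$-algebra of Borel sets in $X$. A $\sigma$-ideal $I\subseteq Bor(X)$ is homogeneous if for each $E\in Bor(X)\setminus I$ there exists a Borel map $f:X\to E$ such that $f^{-1}(A)\in I$ whenever $A\in I$. *)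

(* Defs.v *)
From HB Require Import structures.
From mathcomp Require Import all_boot all_order all_algebra.
From mathcomp Require Import all_classical all_reals all_analysis.

Set Implicit Arguments.
Unset Strict Implicit.
Unset Printing Implicit Defensive.

Import Order.TTheory GRing.Theory Num.Theory.
Import numFieldNormedType.Exports.

Local Open Scope classical_set_scope.
Local Open Scope ring_scope.

(* Spaces are subsets X of an ambient topological space, with the subspace
   topology.  A map X -> E is a function on the ambient space whose values
   outside X are irrelevant, and its inverse images are taken within X. *)

Definition Bor (T : topologicalType) (X : set T) : set (set T) :=
  <<s X, [set X `&` U | U in [set U : set T | open U]] >>.

Definition borel_map (T : topologicalType) (X E : set T) (f : T -> T) : Prop :=
  f @` X `<=` E /\ (forall B, Bor E B -> Bor X (X `&` f @^-1` B)).

Definition sigma_ideal (T : topologicalType) (X : set T) (I : set (set T))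
    : Prop :=
  [/\ I `<=` Bor X, I set0,
      (forall A B, I A -> Bor X B -> B `<=` A -> I B) &
      (forall F : nat -> set T, (forall n, I (F n)) -> I (\bigcup_n F n))].

Definition homogeneous (T : topologicalType) (X : set T) (I : set (set T))
    : Prop :=
  forall E, Bor X E -> ~ I E ->
    exists f : T -> T, borel_map X E f /\
      (forall A, I A -> I (X `&` f @^-1` A)).

Definition compactly_covered (T : topologicalType) (X : set T)
    (P : set T -> Prop) : set (set T) :=
  [set A | Bor X A /\
    exists K : nat -> set T,
      (forall n, [/\ compact (K n), K n `<=` X & P (K n)]) /\
      A `<=` \bigcup_n K n].

(* Only the values of mu on compact subsets of X matter, so mu may be the
   restriction to X of a measure, or of an outer measure, on the ambient
   space. *)
Definition J_f (R : realType) (T : topologicalType) (X : set T)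
    (mu : set T -> \bar R) : set (set T) :=
  compactly_covered X (fun K => (mu K < +oo)%E).

Definition J_0 (R : realType) (T : topologicalType) (X : set T)
    (mu : set T -> \bar R) : set (set T) :=
  compactly_covered X (fun K => mu K = 0%E).

(* The sup norm is the library's norm on R * R, hence an explicit distance. *)
Definition euclidean_dist (R : realType) (p q : R * R) : R :=
  Num.sqrt ((p.1 - q.1) ^+ 2 + (p.2 - q.2) ^+ 2).

(* The point 0 is added so that the empty set has diameter 0 and not -oo. *)
Definition diam (R : realType) (U : set (R * R)) : \bar R :=
  ereal_sup (0%E |` [set (euclidean_dist p q)%:E | p in U & q in U]).

Definition hausdorff1_content (R : realType) (delta : R) (A : set (R * R))
    : \bar R :=
  ereal_inf [set (\sum_(0 <= n <oo) diam (U n))%E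
    | U in [set U : nat -> set (R * R) |
        A `<=` \bigcup_n U n /\ (forall n, (diam (U n) <= delta%:E)%E)]].

Definition hausdorff1 (R : realType) (A : set (R * R)) : \bar R :=
  ereal_sup [set hausdorff1_content delta A | delta in [set d : R | 0 < d]].

Definition unit_interval (R : realType) : set R := [set` `[0, 1]].

Arguments unit_interval : clear implicits.

Definition unit_square (R : realType) : set (R * R) :=
  unit_interval R `*` unit_interval R.
Arguments unit_square : clear implicits.

Arguments hausdorff1 : clear implicits.

Lemma compactly_covered_sigma_ideal (T : topologicalType) (X : set T)
    (P : set T -> Prop) :
  P set0 -> sigma_ideal X (compactly_covered X P).
Proof.
have [BX0 _ BXU] := smallest_sigma_algebra X
  [set X `&` U | U in [set U : set T | open U]].
move=> P0; split.
- by move=> A [].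
- split=> //; exists (fun=> set0); split => // n; split=> //.
  exact: compact0.
- by move=> A B [_ [K [KP AK]]] BB BA; split=> //; exists K; split=> // x /BA/AK.
- move=> F IF; split; first by apply: BXU => n; case: (IF n).
  have /choice[K KP] : forall n, exists K : nat -> set T,
      (forall k, [/\ compact (K k), K k `<=` X & P (K k)]) /\
      F n `<=` \bigcup_k K k by move=> n; case: (IF n).
  exists (fun m => if (unpickle m : option (nat * nat)) is Some p
                   then K p.1 p.2 else set0); split.
    move=> m; case: unpickle => [p|]; first exact: (KP p.1).1.
    by split=> //; exact: compact0.
  move=> x [n _ Fx]; have [k _ Kx] := (KP n).2 x Fx.
  by exists (pickle (n, k)) => //; rewrite pickleK.
Qed.

Lemma hausdorff1_set0 (R : realType) : hausdorff1 R set0 = 0%E.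
Proof.
have d0 (U : set (R * R)) : (0 <= diam U)%E.
  by apply: ereal_sup_ubound; left.
have diam0 : diam (@set0 (R * R)) = 0%E.
  rewrite /diam; have -> : [set (euclidean_dist p q)%:E | p in @set0 (R * R) & q in set0] = set0.
    by apply/seteqP; split=> [x [p []]|].
  by rewrite setU0 ereal_sup1.
apply/eqP; rewrite eq_le; apply/andP; split.
  apply: ge_ereal_sup => _ [d d_gt0 <-].
  apply: ereal_inf_lbound; exists (fun=> set0).
    by split=> // n; rewrite diam0 lee_fin; exact: ltW.
  by rewrite eseries0// => n _ _; rewrite diam0.
apply: (@le_trans _ _ (hausdorff1_content 1 (@set0 (R * R)))).
  by apply: le_ereal_inf_tmp => _ [U _ <-]; exact: nneseries_ge0.
by apply: ereal_sup_ubound; exists 1 => //=.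
Qed.

Lemma J_0_lebesgue_sigma_ideal (R : realType) :
  sigma_ideal (unit_interval R) (J_0 (unit_interval R) (@lebesgue_measure R)).
Proof. exact/compactly_covered_sigma_ideal/measure0. Qed.

Lemma J_0_hausdorff1_sigma_ideal (R : realType) :
  sigma_ideal (unit_square R) (J_0 (unit_square R) (hausdorff1 R)).
Proof. exact/compactly_covered_sigma_ideal/hausdorff1_set0. Qed.

Lemma J_f_hausdorff1_sigma_ideal (R : realType) :
  sigma_ideal (unit_square R) (J_f (unit_square R) (hausdorff1 R)).
Proof. by apply: compactly_covered_sigma_ideal; rewrite hausdorff1_set0. Qed.

(* Main.v *)
(* Let [E] be a dense G_delta subset of [X] that is null (for the Lebesgue
   measure, resp. for [hausdorff1]).  By Baire's theorem [E] is not in the ideal,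
   while every compact subset of [E] is.  Let [mu] be the Lebesgue measure of the
   line, resp. of the plane: a compact set of finite one-dimensional Hausdorff
   measure has zero area, so a compact set contained in a member of the ideal is
   [mu]-null.  If [f : X -> E] is Borel, then by Lusin's theorem [f] is continuous
   on some compact [K] with [mu K > 0]; so [f @` K] is a compact subset of [E],
   hence in the ideal, but its preimage contains [K] and is not. *)

From HB Require Import structures.
Require Import Defs.
From mathcomp Require Import all_boot all_order all_algebra.
From mathcomp Require Import all_classical all_reals all_analysis.
From mathcomp Require Import measurable_realfun.
From mathcomp Require Import lra ring.
Import Order.TTheory GRing.Theory Num.Theory.
Import numFieldNormedType.Exports.
Set Implicit Arguments.
Unset Strict Implicit.
Unset Printing Implicit Defensive.
Local Open Scope classical_set_scope.
Local Open Scope ring_scope.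

(** * Borel sets of a topological space *)

Notation borel T := (g_sigma_algebraType (@open T)).

Lemma exists_invS_lt (R : realType) (e : R) : 0 < e -> exists k, k.+1%:R^-1 < e.
Proof.
move=> e0; exists (Num.truncn e^-1).
by rewrite -ltf_pV2 ?posrE// invrK; exact: truncnS_gt.
Qed.

Lemma open_borel (T : ptopologicalType) (U : set T) :
  open U -> measurable (U : set (borel T)).
Proof. exact: sub_sigma_algebra. Qed.

Lemma closed_borel (T : ptopologicalType) (F : set T) :
  closed F -> measurable (F : set (borel T)).
Proof.
rewrite -openC => /open_borel/measurableC; by rewrite setCK.
Qed.

(** As [X] is closed, the generators [X]&[U] are Borel in the ambient space, and so are complements
    within [X]. *)
Lemma Bor_measurable (T : ptopologicalType) (X B : set T) :
  closed X -> Bor X B -> measurable (B : set (borel T)).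
Proof.
move=> /closed_borel mX.
apply: (@smallest_sub _ (sigma_algebra X) _
  [set A | measurable (A : set (borel T))]).
  split=> [|A mA|F mF]; first exact: measurable0.
    exact: measurableD.
  exact: bigcupT_measurable.
by move=> _ [U oU <-]; apply: measurableI => //; exact: open_borel.
Qed.

(** * Regularity of finite Borel measures *)

(** Continuity from above along the decreasing remainders, whose intersection is empty. It serves to
    replace a countable union of closed sets by a finite one, which is still closed. *)
Lemma finite_measure_bigcup_approx d (T : measurableType d) (R : realType)
    (mu : {measure set T -> \bar R}) (G : nat -> set T) (e : R) :
  (mu setT < +oo)%E ->
  (forall n, measurable (G n)) -> 0 < e ->
  exists N, (mu (\bigcup_n G n `\` \big[setU/set0]_(i < N) G i) < e%:E)%E.
Proof.
move=> fmu mG e0.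
pose F N := \bigcup_n G n `\` \big[setU/set0]_(i < N) G i.
have mF N : measurable (F N).
  by apply: measurableD; [exact: bigcupT_measurable|exact: bigsetU_measurable].
have F0 : \bigcap_N F N = set0.
  apply/seteqP; split=> // x FN; have [[n _ Gnx] _] := FN 0%N I.
  have [_] := FN n.+1 I; rewrite -bigcup_mkord; apply; exists n => //=.
have cF : mu (F N) @[N --> \oo] --> mu (\bigcap_N F N).
  apply: nonincreasing_cvg_mu => //.
  - by apply: le_lt_trans fmu; apply: le_measure => //; rewrite inE.
  - exact: bigcapT_measurable.
  - move=> n m nm; apply/subsetPset => x [Gx nGx]; split=> // Gnx; apply: nGx.
    move: Gnx; rewrite -!bigcup_mkord => -[i /= ilt Gi]; exists i => //=.
    exact: leq_trans ilt nm.
rewrite F0 measure0 in cF.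
have [N _ NF] : \forall N \near \oo, (mu (F N) < e%:E)%E.
  apply: (cF [set x | (x < e%:E)%E]); apply: open_nbhs_nbhs.
  by split; [exact: open_ereal_lt_ereal|rewrite /= lte_fin].
by exists N; exact: NF (leqnn N).
Qed.

Lemma open_bigcup_closed (R : realType) (T : pseudoPMetricType R) (U : set T) :
  open U -> exists2 F : nat -> set T, (forall n, closed (F n)) &
    U = \bigcup_n F n.
Proof.
move=> oU; exists (fun n => ~` \bigcup_(y in ~` U) (ball y n.+1%:R^-1)°).
  move=> n; rewrite closedC; apply: bigcup_open => y _; exact: open_interior.
apply/seteqP; split=> [x Ux|x [n _ Fx]].
  have /nbhs_ballP[e /= e0 xeU] : nbhs x U by apply: open_nbhs_nbhs; split.
  have [n ne] := exists_invS_lt e0.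
  exists n => // -[y nUy /interior_subset/ball_sym yx].
  by apply: nUy; apply: xeU; apply: le_ball yx; exact: ltW.
apply: contrapT => nUx; apply: Fx; exists x => //.
exact: nbhsx_ballx.
Qed.

(** The sets with such approximations form a sigma-algebra containing the open sets; these are
    approximated from inside because they are F_sigma. *)
Lemma borel_regular (R : realType) (T : pseudoPMetricType R)
    (mu : {measure set (borel T) -> \bar R}) (A : set T) (e : R) :
  (mu setT < +oo)%E -> measurable (A : set (borel T)) -> 0 < e ->
  exists F U : set T, [/\ closed F, open U, F `<=` A, A `<=` U &
    (mu (U `\` F) < e%:E)%E].
Proof.
move=> fmu mA; move: A mA e.
have le_mu (A B : set T) : measurable (A : set (borel T)) ->
    measurable (B : set (borel T)) -> A `<=` B -> (mu A <= mu B)%E.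
  by move=> mA mB AB; apply: le_measure => //; rewrite inE.
apply: smallest_sub; first split.
- move=> e e0; exists set0, set0; split=> //; [exact: closed0|exact: open0|].
  by rewrite setDv measure0 lte_fin.
- move=> A regA e /regA[F [U [cF oU FA AU muUF]]].
  exists (~` U), (~` F); split.
  + by rewrite closedC.
  + by rewrite openC.
  + by rewrite setTD; exact: subsetC.
  + by rewrite setTD; exact: subsetC.
  + by rewrite setDE setCK setIC -setDE.
- move=> A regA e e0.
  (* Half of [e] is spread over the gaps [U n]\[F n]; the other half pays for cutting the union of
     the [F n] down to a finite one. *)
  have /choice[FU HFU] : forall n, exists FU : set T * set T,
      [/\ closed FU.1, open FU.2, FU.1 `<=` A n, A n `<=` FU.2 &
      (mu (FU.2 `\` FU.1) < (e / 2 / (2 ^ n.+1)%:R)%:E)%E].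
    move=> n; have [|F [U HFU]] := regA n (e / 2 / (2 ^ n.+1)%:R).
      by rewrite !divr_gt0// ltr0n expn_gt0.
    by exists (F, U).
  pose F n := (FU n).1; pose U n := (FU n).2.
  have cF n : closed (F n) by have [] := HFU n.
  have oU n : open (U n) by have [] := HFU n.
  have mF n : measurable (F n : set (borel T)) by exact: closed_borel.
  have mU n : measurable (U n : set (borel T)) by exact: open_borel.
  have [N FN] := finite_measure_bigcup_approx fmu mF (divr_gt0 e0 (ltr0n _ 2)).
  exists (\big[setU/set0]_(i < N) F i), (\bigcup_n U n); split.
  + by apply: closed_bigsetU => i _.
  + by apply: bigcup_open => i _.
  + rewrite -bigcup_mkord => x [i _ Fx]; exists i => //.
    by have [_ _ + _ _] := HFU i; exact.
  + by move=> x [i _ Ax]; exists i => //; have [_ _ _ + _] := HFU i; exact.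
  + set W := \big[_/_]_(i < N) _.
    have mW : measurable (W : set (borel T)) by exact: bigsetU_measurable.
    have mF' : measurable (\bigcup_n F n : set (borel T)).
      exact: bigcupT_measurable.
    have mD : measurable (\bigcup_n (U n `\` F n) : set (borel T)).
      by apply: bigcupT_measurable => n; exact: measurableD.
    apply: (@le_lt_trans _ _ (mu ((\bigcup_n F n `\` W) `|`
        \bigcup_n (U n `\` F n)))).
      apply: le_mu.
      - by apply: measurableD => //; exact: bigcupT_measurable.
      - by apply: measurableU => //; exact: measurableD.
      - move=> x [[n _ Ux] nWx]; have [Fx|nFx] := pselect (F n x).
          by left; split=> //; exists n.
        by right; exists n.
    apply: (@le_lt_trans _ _ (mu (\bigcup_n F n `\` W) +
        mu (\bigcup_n (U n `\` F n)))%E).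
      by apply: measureU2 => //; exact: measurableD.
    rewrite [e in ltRHS]splitr EFinD; apply: lte_leD => //.
      by rewrite ge0_fin_numE//; apply: le_lt_trans fmu; exact: le_mu.
    apply: (@le_trans _ _ (\sum_(0 <= n <oo) mu (U n `\` F n))%E).
      apply: measure_sigma_subadditive => // n; exact: measurableD.
    apply: le_trans (epsilon_trick0 xpredT (ltW (divr_gt0 e0 (ltr0n _ 2)))).
    apply: lee_nneseries => // n _; apply: ltW; by have [] := HFU n.
- move=> V oV e e0; have [F cF VF] := open_bigcup_closed oV.
  have mF n : measurable (F n : set (borel T)) by exact: closed_borel.
  have [N FN] := finite_measure_bigcup_approx fmu mF e0.
  exists (\big[setU/set0]_(i < N) F i), V; split=> //.
  + by apply: closed_bigsetU.
  + by rewrite VF -bigcup_mkord => x [i _ Fx]; exists i.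
  + by rewrite VF.
Qed.

(** * Countable bases and Lusin's theorem *)

Definition open_base (T : topologicalType) (B : nat -> set T) : Prop :=
  (forall n, open (B n)) /\
  forall U x, open U -> U x -> exists2 n, B n x & B n `<=` U.

(** One index codes a pair (centre, radius); an index coding no pair gives the empty set, which is
    open. *)
Definition ball_base (R : realType) (T : normedModType R) (q : nat -> T)
    (m : nat) : set T :=
  if (unpickle m : option (nat * nat)) is Some p
  then ball (q p.1) p.2.+1%:R^-1 else set0.

Lemma dense_open_base (R : realType) (T : normedModType R) (q : nat -> T) :
  dense (range q) -> open_base (ball_base q).
Proof.
move=> dq; split.
  move=> m; rewrite /ball_base; case: unpickle => [p|]; last exact: open0.
  by apply: ball_open; rewrite invr_gt0.
move=> U x oU Ux.
have /nbhs_ballP[e /= e0 xeU] : nbhs x U by exact: open_nbhs_nbhs.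
(* With radius below [e / 2], a ball that contains [x] stays within [e] of [x]. *)
have [k ke] := exists_invS_lt (divr_gt0 e0 (ltr0n _ 2)).
pose r : R := k.+1%:R^-1.
have r0 : 0 < r by rewrite invr_gt0.
have [y [bxy [n _ qny]]] : (ball x r `&` range q) !=set0.
  by apply: dq; [exists x; exact: ballxx|exact: ball_open].
have xy : ball (q n) r x by rewrite qny; exact: ball_sym.
exists (pickle (n, k)); rewrite /ball_base pickleK//= => z qz.
apply: xeU; rewrite [e]splitr.
apply: ball_triangle (le_ball (ltW ke) qz).
by apply: (le_ball (ltW ke)); rewrite qny.
Qed.

(* For each basic open [B n] take [F `<=` X `&` f @^-1` B n `<=` U] with [F]
   closed, [U] open and [U `\` F] small: away from the sets [U `\` F], the
   preimages of basic open sets are relatively open. *)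
Lemma lusin (R : realType) (T : pseudoPMetricType R) (T' : topologicalType)
    (mu : {measure set (borel T) -> \bar R}) (B : nat -> set T')
    (X : set T) (f : T -> T') (e : R) :
  open_base B -> closed X -> (mu X < +oo)%E ->
  (forall V, open V -> measurable (X `&` f @^-1` V : set (borel T))) ->
  0 < e ->
  exists K, [/\ closed K, K `<=` X, {within K, continuous f} &
    (mu (X `\` K) < e%:E)%E].
Proof.
move=> [oB baseB] cX muX mf e0.
have mX : measurable (X : set (borel T)) by exact: closed_borel.
(* [mu] is finite only on [X], so regularity is applied to its restriction. *)
pose nu : {measure set (borel T) -> \bar R} := mrestr mu mX.
have finnu : (nu setT < +oo)%E by rewrite /nu /= /mrestr setTI.
have e2 : 0 < e / 2 by rewrite divr_gt0.
have /choice[FU HFU] n : exists FU : set T * set T,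
    [/\ closed FU.1, open FU.2, FU.1 `<=` X `&` f @^-1` B n,
      X `&` f @^-1` B n `<=` FU.2 &
      (nu (FU.2 `\` FU.1) < (e / 2 / (2 ^ n.+1)%:R)%:E)%E].
  have [|F [U HFU]] := borel_regular finnu (mf _ (oB n))
    (e := e / 2 / (2 ^ n.+1)%:R).
    by rewrite divr_gt0// ltr0n expn_gt0.
  by exists (F, U).
pose D n := (FU n).2 `\` (FU n).1.
have oD n : open (D n).
  by have [cF oU _ _ _] := HFU n; apply: openI => //; rewrite openC.
have mD n : measurable (D n : set (borel T)) by exact: open_borel.
exists (X `\` \bigcup_n D n); split.
- by apply: closedI => //; rewrite closedC; apply: bigcup_open => n _.
- by move=> x [].
- apply/subspace_continuousP => x [Xx nDx] V /=.
  rewrite nbhsE => -[W [oW Wfx] WV].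
  have [n Bnfx BnW] := baseB _ _ oW Wfx.
  have [_ oU FX XU _] := HFU n.
  have xU : nbhs x (FU n).2 by apply: open_nbhs_nbhs; split=> //; apply: XU.
  apply: filterS xU => y Uy [Xy nDy]; apply: WV; apply: BnW.
  have Fy : (FU n).1 y by apply: contrapT => nFy; apply: nDy; exists n.
  by have [] := FX _ Fy.
- rewrite setDD.
  (* Summing the gaps gives a non-strict bound; the factor 1/2 makes it strict. *)
  apply: (@le_lt_trans _ _ (e / 2)%:E); last first.
    by rewrite lte_fin ltr_pdivrMr// ltr_pMr// ltr1n.
  rewrite setIC -[leLHS]/(nu (\bigcup_n D n)).
  apply: (@le_trans _ _ (\sum_(0 <= n <oo) nu (D n))%E).
    apply: measure_sigma_subadditive => //; exact: bigcupT_measurable.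
  apply: le_trans (epsilon_trick0 xpredT (ltW e2)).
  by apply: lee_nneseries => // n _; apply: ltW; have [] := HFU n.
Qed.

(* These balls have radii summing to [1 / (k + 1)], so the dense G_delta set
   [\bigcap_k thin_nbhs q k] is null. *)
Definition thin_nbhs (R : realType) (T : normedModType R) (q : nat -> T)
    (k : nat) : set T :=
  \bigcup_n ball (q n) (k.+1%:R^-1 / (2 ^ n.+1)%:R).

(** * Relative Borel sets and the criterion for non-homogeneity *)

Lemma Bor_Gdelta (T : topologicalType) (X : set T) (O : nat -> set T) :
  (forall k, open (O k)) -> Bor X (X `&` \bigcap_k O k).
Proof.
move=> oO; have [_ BD BU] := smallest_sigma_algebra X
  [set X `&` U | U in [set U : set T | open U]].
have -> : X `&` \bigcap_k O k = X `\` \bigcup_k (X `\` (X `&` O k)).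
  apply/seteqP; split=> [x [Xx Ox]|x [Xx nOx]].
    by split=> // -[k _ [_]]; apply; split=> //; exact: Ox.
  split=> // k _; apply: contrapT => nOkx.
  by apply: nOx; exists k => //; split=> // -[].
apply: (BD); apply: BU => k; apply: (BD); apply: sub_sigma_algebra.
by exists (O k) => //; exact: oO.
Qed.

Lemma Bor_closed (T : topologicalType) (X F : set T) :
  closed F -> F `<=` X -> Bor X F.
Proof.
move=> cF FX; have [_ BD _] := smallest_sigma_algebra X
  [set X `&` U | U in [set U : set T | open U]].
have -> : F = X `\` (X `&` ~` F) by rewrite setDIr setDv set0U setDE setCK setIidr.
by apply: BD; apply: sub_sigma_algebra; exists (~` F) => //=; rewrite openC.
Qed.

(** Common form of the three cases: [P] is the smallness required of the covering compact sets, and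
    [mu] is an auxiliary measure for which such sets are null. *)
Lemma not_homogeneous_compactly_covered (R : realType)
    (T : completeNormedModType R) (q : nat -> T) (X : set T)
    (mu : {measure set (borel T) -> \bar R}) (P : set T -> Prop) :
  dense (range q) -> compact X -> X° !=set0 -> (mu X < +oo)%E ->
  (forall U, open U -> U !=set0 -> (0 < mu U)%E) ->
  (forall K, compact K -> P K -> mu K = 0%E) ->
  (forall K, compact K -> K `<=` \bigcap_k thin_nbhs q k -> P K) ->
  ~ homogeneous X (compactly_covered X P).
Proof.
move=> dq cpX X0 muX mu_gt0 Pmu thinP homX.
have haus : hausdorff_space T := @norm_hausdorff _ T.
have cX : closed X by exact: compact_closed.
have mX : measurable (X : set (borel T)) by exact: closed_borel.
have le_mu (A B : set T) : measurable (A : set (borel T)) ->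
    measurable (B : set (borel T)) -> A `<=` B -> (mu A <= mu B)%E.
  by move=> mA mB AB; apply: le_measure => //; rewrite inE.
have radius_gt0 k n : 0 < k.+1%:R^-1 / (2 ^ n.+1)%:R :> R.
  by rewrite divr_gt0// ltr0n expn_gt0.
have oO k : open (thin_nbhs q k).
  by apply: bigcup_open => n _; exact: ball_open.
pose E := X `&` \bigcap_k thin_nbhs q k.
have mX0 : (0 < mu X)%E.
  apply: lt_le_trans (mu_gt0 _ (@open_interior _ X) X0) _.
  apply: le_mu => //; last exact: interior_subset.
  by apply: open_borel; exact: open_interior.
(* If compact sets [K n] with [P] covered [E], each would be null, hence with dense complement,
   since nonempty open sets have positive measure. Baire's theorem applied to the sets [D n] then
   yields a point of [E] outside every [K n]. *)
have nIE : ~ compactly_covered X P E.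
  move=> [_ [K [HK EK]]].
  pose D n := thin_nbhs q n `&` ~` K n.
  have odD n : open (D n) /\ dense (D n).
    have [cK KX PK] := HK n.
    have oK : open (~` K n) by rewrite openC; exact: compact_closed.
    split; first exact: openI.
    apply: denseI => //.
      move=> U U0 oU; have [x [Ux [m _ qmx]]] := dq U U0 oU.
      exists x; split=> //; exists m => //; rewrite qmx.
      exact: ballxx.
    move=> U U0 oU; apply/set0P/eqP => UK0.
    have := mu_gt0 U oU U0; suff -> : mu U = 0%E by rewrite ltxx.
    apply/eqP; rewrite -measure_le0 -(Pmu (K n))//; apply: le_mu.
    + exact: open_borel.
    + by apply: closed_borel; exact: compact_closed.
    + exact/subsets_disjoint.
  have [x [/interior_subset Xx Dx]] := Baire odD X0 (@open_interior _ X).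
  have [|n _ Knx] := EK x.
    by split=> // n _; have [] := Dx n I.
  by have [_] := Dx n I.
have [f [[fXE mf] If]] := homX E (@Bor_Gdelta _ X _ oO) nIE.
have mfV V : open V -> measurable (X `&` f @^-1` V : set (borel T)).
  move=> oV; apply: (@Bor_measurable _ X) => //.
  (* [f] is Borel as a map into [E], so an open [V] has to be replaced by its trace on [E]. *)
  have -> : X `&` f @^-1` V = X `&` f @^-1` (E `&` V).
    apply/seteqP; split=> x [Xx Vx]; split=> //; last by case: Vx.
    by split=> //; apply: fXE; exists x.
  by apply: mf; apply: sub_sigma_algebra; exists V.
(* Taking [e] to be the measure of [X] forces [mu K > 0]; the rest shows [mu K = 0], whence
   [mu X <= mu (X]\[K)], a contradiction. *)
have [|K [cK KX Kf]] := lusin (dense_open_base dq) cX muX mfV (e := fine (mu X)).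
  by rewrite fine_gt0// mX0.
rewrite fineK ?ge0_fin_numE//; apply/negP; rewrite -leNgt.
have mK : measurable (K : set (borel T)) by exact: closed_borel.
have cpK : compact K by exact: subclosed_compact cpX KX.
have cpfK : compact (f @` K) by exact: continuous_compact.
have fKE : f @` K `<=` E by move=> _ [x /KX Xx <-]; apply: fXE; exists x.
have IfK : compactly_covered X P (f @` K).
  split; last first.
    exists (fun=> f @` K); split; last by move=> x Kx; exists 0%N.
    move=> n; split=> //; first by move=> x /fKE[].
    by apply: thinP => // x /fKE[].
  by apply: Bor_closed; [exact: compact_closed|move=> x /fKE[]].
have [_ [C [HC KC]]] := If _ IfK.
have mC n : measurable (C n : set (borel T)).
  by apply: closed_borel; apply: compact_closed; case: (HC n).
have muK : mu K = 0%E.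
  apply/eqP; rewrite -measure_le0.
  apply: (@le_trans _ _ (\sum_(0 <= n <oo) mu (C n))%E).
    apply: measure_sigma_subadditive => // x Kx; apply: KC.
    by split; [exact: KX|exists x].
  by rewrite eseries0// => n _ _; have [? _ ?] := HC n; exact: Pmu.
have XE : X = K `|` (X `\` K) by rewrite setDUK.
rewrite {1}XE; apply: le_trans (measureU2 _ _ _) _ => //.
  exact: measurableD.
by rewrite [X in (X + _)%E]muK add0e.
Qed.

(* Without the pointed instances on products, [R * R] is not seen as a
   completeNormedModType, which Baire's theorem requires. *)
HB.saturate prod.

(** * Completeness of products *)

Lemma prod_complete (U V : completeType) (F : set_system (U * V)) :
  ProperFilter F -> cauchy F -> cvg F.
Proof.
move=> FF Fc.
have /cauchy_cvg Fa : cauchy (fst @ F).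
  move=> A entA; have := Fc _ (prod_entP entA (@entourageT V)).
  by rewrite /= !near_simpl -!near2E near_map2; apply: filterS => xy [].
have /cauchy_cvg Fb : cauchy (snd @ F).
  move=> A entA; have := Fc _ (prod_entP (@entourageT U) entA).
  by rewrite /= !near_simpl -!near2E near_map2; apply: filterS => xy [].
apply/cvg_ex; exists (lim (fst @ F), lim (snd @ F)).
(* Writing [F] as its image under pairing of the projections reduces its convergence to that of the
   two coordinates. *)
rewrite -[F in F --> _](_ : ((fun x => (x.1, x.2)) @ F) = F).
  exact: cvg_pair Fa Fb.
apply/funext => A; apply/propext; split => /=; apply: filterS => -[] //.
Qed.

HB.instance Definition _ (U V : completeType) :=
  Uniform_isComplete.Build (U * V)%type (@prod_complete U V).
HB.instance Definition _ (K : numFieldType) (U V : completeNormedModType K) :=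
  Complete.on (U * V)%type.

(** * Borel measures by transport, and countable dense sets *)

(** Used with [f] the identity, to carry Lebesgue measure from the sigma-algebra on which it is
    defined to the one generated by the open sets. *)
Lemma borel_measure d (T1 : measurableType d) (T : ptopologicalType)
    (R : realType) (m : {measure set T1 -> \bar R}) (f : T1 -> T) :
  (forall U, open U -> measurable (f @^-1` U)) ->
  exists mu : {measure set (borel T) -> \bar R}, forall A, mu A = m (f @^-1` A).
Proof.
move=> mf.
have mf' : measurable_fun setT (f : T1 -> borel T).
  apply: (@measurability _ _ _ (borel T) _ _ open) => //= _ [U oU <-].
  by rewrite setTI; exact: mf.
by unshelve refine (ex_intro _
  (pushforward m (f : T1 -> borel T) : {measure set (borel T) -> \bar R}) _).
Qed.

Definition rat_seq (R : realType) (n : nat) : R :=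
  if (unpickle n : option rat) is Some r then ratr r else 0.
Arguments rat_seq : clear implicits.

Definition rat_pair_seq (R : realType) (n : nat) : R * R :=
  if (unpickle n : option (rat * rat)) is Some r then (ratr r.1, ratr r.2) else 0.
Arguments rat_pair_seq : clear implicits.

Lemma dense_rat_seq (R : realType) : dense (range (rat_seq R)).
Proof.
move=> U U0 oU; have [y [Uy [r _ rE]]] := dense_rat U0 oU.
exists y; split=> //; rewrite -rE.
by exists (pickle r) => //; rewrite /rat_seq pickleK.
Qed.

Lemma dense_rat_pair_seq (R : realType) : dense (range (rat_pair_seq R)).
Proof.
move=> U [x Ux] oU.
have /nbhs_ballP[e /= e0 xeU] : nbhs x U by exact: open_nbhs_nbhs.
have dr (y : R) : exists r : rat, ball y e (ratr r).
  have [z [yz [r _ rE]]] : (ball y e `&` range ratr) !=set0.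
    by apply: dense_rat; [exists y; exact: ballxx|exact: ball_open].
  by exists r; rewrite rE.
have [[r1 xr1] [r2 xr2]] := (dr x.1, dr x.2).
exists (ratr r1, ratr r2); split; first by apply: xeU; split.
by exists (pickle (r1, r2)) => //; rewrite /rat_pair_seq pickleK.
Qed.

(** * The unit interval with Lebesgue measure *)

(** The balls making up [thin_nbhs _ k] have lengths summing to 2/(k+1). *)
Lemma lebesgue_thin (R : realType) (K : set R) :
  compact K -> K `<=` \bigcap_k thin_nbhs (rat_seq R) k ->
  lebesgue_measure K = 0%E.
Proof.
move=> cK Kthin; apply/eqP; rewrite -measure_le0; apply/lee_addgt0Pr => e e0.
rewrite add0e; have [k ke] := exists_invS_lt (divr_gt0 e0 (ltr0n _ 2)).
have k0 : 0 <= k.+1%:R^-1 *+ 2 :> R by rewrite mulrn_wge0.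
apply: (@le_trans _ _ (k.+1%:R^-1 *+ 2)%:E); last first.
  by rewrite lee_fin -[_ *+ 2]mulr_natr -ler_pdivlMr// ltW.
apply: le_trans (epsilon_trick0 xpredT k0).
pose B n := ball (rat_seq R n) (k.+1%:R^-1 / (2 ^ n.+1)%:R).
apply: (@le_trans _ _ (\sum_(0 <= n <oo) lebesgue_measure (B n))%E).
  apply: measure_sigma_subadditive => //.
  - by move=> n; exact: measurable_ball.
  - exact: compact_measurable.
  - by move=> x /Kthin /(_ k I).
apply: lee_nneseries => // n _.
by rewrite lebesgue_measure_ball ?lee_fin -?mulrnAl// divr_ge0.
Qed.

Lemma interior_unit_interval (R : realType) : (unit_interval R)° 2^-1.
Proof.
rewrite /unit_interval interior_itv/= in_itv/= invr_gt0 ltr0n/=.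
by rewrite invf_lt1// ltr1n.
Qed.

Lemma J_0_lebesgue_not_homogeneous (R : realType) :
  ~ homogeneous (unit_interval R) (J_0 (unit_interval R) (@lebesgue_measure R)).
Proof.
have [U oU|mu muE] := @borel_measure _ (measurableTypeR R) R R
  (@lebesgue_measure R) id; first exact: open_measurable.
apply: (@not_homogeneous_compactly_covered R R (rat_seq R) _ mu).
- exact: dense_rat_seq.
- exact: segment_compact.
- by exists 2^-1; exact: interior_unit_interval.
- rewrite muE/= preimage_id /unit_interval lebesgue_measure_itv/= lte_fin ltr01.
  by rewrite -EFinB ltry.
- move=> U oU [x Ux]; rewrite muE/= preimage_id.
  have /nbhs_ballP[e /= e0 xeU] : nbhs x U by exact: open_nbhs_nbhs.
  apply: (@lt_le_trans _ _ (lebesgue_measure (ball x e))).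
    by rewrite lebesgue_measure_ball ?lte_fin ?mulrn_wgt0// ltW.
  apply: le_measure => //; rewrite inE; first exact: measurable_ball.
  exact: open_measurable.
- by move=> K cK; rewrite muE.
- exact: lebesgue_thin.
Qed.

(** * The unit square: area and Hausdorff measure *)

Section lebesgue_plane.
Variable R : realType.
Local Notation lambda := (@lebesgue_measure R).
Local Notation plane := (measurableTypeR R * measurableTypeR R)%type.
Local Notation lambda2 := (lambda \x lambda)%E.

Lemma lambda2_setX (A B : set (measurableTypeR R)) : measurable A -> measurable B ->
  (lambda2 (A `*` B) = lambda A * lambda B)%E.
Proof. exact: product_measure1E. Qed.

Lemma plane_ballE (x : R * R) (e : R) : ball x e = ball x.1 e `*` ball x.2 e.
Proof. by []. Qed.

Lemma measurable_plane_ball (x : R * R) (e : R) : measurable (ball x e : set plane).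
Proof. by apply: measurableX; exact: measurable_ball. Qed.

(** Balls of the sup norm are products of intervals, and countably many of them form a base. *)
Lemma open_measurable_plane (U : set (R * R)) :
  open U -> measurable (U : set plane).
Proof.
move=> oU; have [_ base] := dense_open_base (@dense_rat_pair_seq R).
pose B := ball_base (rat_pair_seq R).
have -> : U = \bigcup_(n in [set n | B n `<=` U]) B n.
  apply/seteqP; split=> [x Ux|x [n BU]]; last exact: BU.
  by have [n Bx BU] := base U x oU Ux; exists n.
apply: bigcup_measurable => n _; rewrite /B /ball_base.
by case: unpickle => [p|]; [exact: measurable_plane_ball|exact: measurable0].
Qed.

Lemma closed_measurable_plane (F : set (R * R)) :
  closed F -> measurable (F : set plane).
Proof.
by rewrite -openC => /open_measurable_plane/measurableC; rewrite setCK.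
Qed.

Lemma lambda2_open_gt0 (U : set (R * R)) : open U -> U !=set0 -> (0 < lambda2 U)%E.
Proof.
move=> oU [x Ux].
have /nbhs_ballP[e /= e0 xeU] : nbhs x U by exact: open_nbhs_nbhs.
apply: (@lt_le_trans _ _ (lambda2 (ball x e))).
  rewrite plane_ballE lambda2_setX; try exact: measurable_ball.
  by rewrite !lebesgue_measure_ball ?ltW// -EFinM lte_fin mulr_gt0// mulrn_wgt0.
apply: le_measure => //; rewrite inE; first exact: measurable_plane_ball.
exact: open_measurable_plane.
Qed.

Lemma lambda2_unit_square : (lambda2 (unit_square R) < +oo)%E.
Proof.
rewrite /unit_square lambda2_setX; try exact: measurable_itv.
by rewrite !lebesgue_measure_itv/= lte_fin ltr01 -EFinB -EFinM ltry.
Qed.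

Lemma lambda2_square (x : R * R) (r : R) : 0 <= r ->
  lambda2 (`[x.1 - r, x.1 + r] `*` `[x.2 - r, x.2 + r]) = ((r *+ 2) ^+ 2)%:E.
Proof.
move=> r0; rewrite lambda2_setX; try exact: measurable_itv.
suff itvE (a : R) : lambda `[a - r, a + r]%classic = (r *+ 2)%:E by rewrite !itvE.
rewrite lebesgue_measure_itv/= lte_fin ltrBlDr -addrA ltrDl.
have [r_gt0|] := ltP 0 (r + r); first by rewrite -EFinB; congr EFin; ring.
move=> ?; have -> : r = 0 by lra.
by rewrite mul0rn.
Qed.

Lemma euclidean_dist_ge1 (p q : R * R) : `|p.1 - q.1| <= euclidean_dist p q.
Proof.
rewrite -(@sqrtr_sqr R); apply: ler_wsqrtr.
by rewrite lerDl sqr_ge0.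
Qed.

Lemma euclidean_dist_ge2 (p q : R * R) : `|p.2 - q.2| <= euclidean_dist p q.
Proof.
rewrite -(@sqrtr_sqr R); apply: ler_wsqrtr.
by rewrite lerDr sqr_ge0.
Qed.

Lemma euclidean_dist_le (p q : R * R) :
  euclidean_dist p q <= `|p.1 - q.1| + `|p.2 - q.2|.
Proof.
have a0 := normr_ge0 (p.1 - q.1); have b0 := normr_ge0 (p.2 - q.2).
rewrite -[leRHS]ger0_norm ?addr_ge0// -sqrtr_sqr; apply: ler_wsqrtr.
rewrite -[X in X + _]real_normK ?num_real//.
by rewrite -[X in _ + X <= _]real_normK ?num_real//; nra.
Qed.

Lemma diam_ge0 (U : set (R * R)) : (0 <= diam U)%E.
Proof. by apply: ereal_sup_ubound; left. Qed.

(** The ball is a square of side [2 r], and the Euclidean distance is at most the sum of the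
    coordinate distances. *)
Lemma diam_ball_le (x : R * R) (r : R) : 0 <= r ->
  (diam (ball x r) <= (r *+ 4)%:E)%E.
Proof.
move=> r0; apply: ge_ereal_sup => _ [->|[p xp [q xq <-]]]; rewrite lee_fin.
  by rewrite mulrn_wge0.
move: xp xq => [/ltW p1 /ltW p2] [/ltW q1 /ltW q2].
apply: le_trans (euclidean_dist_le p q) _.
have := ler_distD x.1 p.1 q.1; have := ler_distD x.2 p.2 q.2.
rewrite (distrC p.1 x.1) (distrC p.2 x.2) => ? ?.
by rewrite /= in p1 p2 q1 q2 *; lra.
Qed.

Lemma hausdorff1_ge0 (A : set (R * R)) : (0 <= hausdorff1 R A)%E.
Proof.
apply: (@le_trans _ _ (hausdorff1_content 1 A)).
  apply: le_ereal_inf_tmp => _ [U _ <-]; apply: nneseries_ge0 => n _ _.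
  exact: diam_ge0.
by apply: ereal_sup_ubound; exists 1 => //=.
Qed.

Lemma hausdorff1_thin (A : set (R * R)) :
  A `<=` \bigcap_k thin_nbhs (rat_pair_seq R) k -> hausdorff1 R A = 0%E.
Proof.
move=> Athin; apply/eqP; rewrite eq_le hausdorff1_ge0 andbT.
apply: ge_ereal_sup => _ [d /= d0 <-]; apply/lee_addgt0Pr => e e0; rewrite add0e.
(* The 4 comes from [diam_ball_le]. Staying below [d] makes the balls an admissible cover at scale
   [d]; staying below [e] bounds the sum of their diameters. *)
have de0 : 0 < Num.min d e / 4 by rewrite divr_gt0// lt_min d0 e0.
have [k] := exists_invS_lt de0; rewrite ltr_pdivlMr// lt_min => /andP[kd ke].
pose r n : R := k.+1%:R^-1 / (2 ^ n.+1)%:R.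
have r0 n : 0 <= r n by rewrite divr_ge0.
have k0 : 0 <= k.+1%:R^-1 *+ 4 :> R by rewrite mulrn_wge0.
apply: (@le_trans _ _ (\sum_(0 <= n <oo) diam (ball (rat_pair_seq R n) (r n)))%E).
  apply: ereal_inf_lbound; exists (fun n => ball (rat_pair_seq R n) (r n)) => //.
  split; first by move=> x /Athin /(_ k I).
  move=> n; apply: le_trans (diam_ball_le _ (r0 n)) _; rewrite lee_fin.
  rewrite (le_trans _ (ltW kd))// -[_ *+ 4]mulr_natr ler_pM2r// /r ler_piMr//.
  by rewrite invf_le1 ?ler1n ?ltr0n expn_gt0.
apply: (@le_trans _ _ (k.+1%:R^-1 *+ 4)%:E); last first.
  by rewrite lee_fin -[_ *+ 4]mulr_natr ltW.
apply: le_trans (epsilon_trick0 xpredT k0).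
apply: lee_nneseries => [n _ _|n _]; first exact: diam_ge0.
by rewrite mulrnAl; exact: diam_ball_le.
Qed.

(* A set of diameter [r] lies in a square of area [4 r^2], and [4 r^2 <= 4 d r]
   when [r <= d]. *)
Lemma hausdorff1_lty_lambda2 (K : set (R * R)) :
  measurable (K : set plane) -> (hausdorff1 R K < +oo)%E -> lambda2 K = 0%E.
Proof.
move=> mK Kfin.
have [M M0 KM] : exists2 M : R, 0 < M & (hausdorff1 R K < M%:E)%E.
  have := hausdorff1_ge0 K; case: (hausdorff1 R K) Kfin => [h| |]// _.
  rewrite lee_fin => h0; exists (h + 1); first by rewrite ltr_wpDl.
  by rewrite lte_fin ltrDl.
apply/eqP; rewrite -measure_le0; apply/lee_addgt0Pr => e e0; rewrite add0e.
(* Chosen so that [4 * d * M = e], where [M] will bound the sum of the diameters of a cover at scale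
   [d]. *)
pose d := e / (4 * M).
have d0 : 0 < d by rewrite divr_gt0// mulr_gt0.
have /ereal_inf_lt[_ [U [KU dU] <-] UM] : (hausdorff1_content d K < M%:E)%E.
  by apply: le_lt_trans KM; apply: ereal_sup_ubound; exists d.
have Ufin n : diam (U n) = (fine (diam (U n)))%:E.
  rewrite fineK// ge0_fin_numE ?diam_ge0//; exact: le_lt_trans (dU n) (ltry _).
pose r n := fine (diam (U n)).
have r0 n : 0 <= r n by rewrite fine_ge0// diam_ge0.
have rd n : r n <= d by rewrite -lee_fin -Ufin.
have /choice[x HU] n : exists x : R * R,
    U n `<=` `[x.1 - r n, x.1 + r n] `*` `[x.2 - r n, x.2 + r n].
  (* Any point of [U n] can be the centre; an empty [U n] gets the arbitrary centre 0. *)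
  have [->|/set0P[x Ux]] := eqVneq (U n) set0; first by exists 0.
  exists x => y Uy.
  have xyr : euclidean_dist y x <= r n.
    rewrite -lee_fin -Ufin; apply: ereal_sup_ubound; right.
    by exists y => //; exists x.
  have := le_trans (euclidean_dist_ge1 y x) xyr.
  have := le_trans (euclidean_dist_ge2 y x) xyr.
  by rewrite !ler_distl /= !in_itv/=.
pose Q n : set plane :=
  `[(x n).1 - r n, (x n).1 + r n] `*` `[(x n).2 - r n, (x n).2 + r n].
apply: (@le_trans _ _ (\sum_(0 <= n <oo) lambda2 (Q n))%E).
  apply: measure_sigma_subadditive => //.
    by move=> n; apply: measurableX; exact: measurable_itv.
  by move=> y /KU[n _ Uy]; exists n => //; exact: HU.
apply: (@le_trans _ _ (\sum_(0 <= n <oo) (4 * d)%:E * diam (U n))%E).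
  apply: lee_nneseries => // n _.
  rewrite /Q lambda2_square// Ufin -/(r n) -EFinM lee_fin.
  have := r0 n; have := rd n; nra.
rewrite nneseriesZl; last by move=> n _; exact: diam_ge0.
have -> : e%:E = ((4 * d)%:E * M%:E)%E.
  by rewrite -EFinM /d; congr EFin; field; rewrite gt_eqF.
by apply: lee_wpmul2l; [rewrite lee_fin mulr_ge0// ltW|exact: ltW].
Qed.

(** Nullity and finiteness of [hausdorff1] both meet these two bounds on [P], so [J_0] and [J_f] are
    treated at once. *)
Lemma plane_not_homogeneous (P : set (R * R) -> Prop) :
  (forall K, P K -> (hausdorff1 R K < +oo)%E) ->
  (forall K, hausdorff1 R K = 0%E -> P K) ->
  ~ homogeneous (unit_square R) (compactly_covered (unit_square R) P).
Proof.
move=> Pfin P0.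
have [U oU|mu muE] := @borel_measure _ plane (R * R)%type R lambda2 id.
  exact: open_measurable_plane.
apply: (@not_homogeneous_compactly_covered R (R * R)%type (rat_pair_seq R) _ mu).
- exact: dense_rat_pair_seq.
- by apply: compact_setX; exact: segment_compact.
- exists (2^-1, 2^-1); exists (unit_interval R, unit_interval R) => //.
  by split; exact: interior_unit_interval.
- by rewrite muE; exact: lambda2_unit_square.
- by move=> U oU U0; rewrite muE; exact: lambda2_open_gt0.
- move=> K cK PK; rewrite muE; apply: hausdorff1_lty_lambda2; last exact: Pfin.
  by apply: closed_measurable_plane; exact: compact_closed.
- by move=> K _ /hausdorff1_thin/P0.
Qed.

End lebesgue_plane.

Theorem corollary6p2p2 (R : realType) :
  ~ homogeneous (unit_interval R)
      (J_0 (unit_interval R) (@lebesgue_measure R)) /\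
  ~ homogeneous (unit_square R)
      (J_0 (unit_square R) (hausdorff1 R)) /\
  ~ homogeneous (unit_square R)
      (J_f (unit_square R) (hausdorff1 R)).
Proof.
split; first exact: J_0_lebesgue_not_homogeneous.
split; apply: plane_not_homogeneous => K.
- by move=> ->.
- by [].
- by [].
- by move=> ->.
Qed.
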